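(* Let $M_c$ be a melon graph that is a comparability graph. Then $\mathcal{R}^p(M_c)=3$ if and only if $M_c$ contains an even cycle $C_{2n}$, for some $n\ge 3$, or the graph $T_2$ as an induced subgraph.
   Context: All graphs are finite and simple. A melon graph $M=(E_1,\ldots,E_m)$ ($m\ge 1$) is the graph formed as the union of $m$ paths $E_1,\ldots,E_m$ (the constituent paths), all having the same two distinct endpoints $0$ and $0'$, and pairwise sharing no vertices other than $0$ and $0'$; since $M$ is simple, at most one constituent path has length one (length = number of edges). A comparability graph is a graph admitting a transitive orientation. $C_{2n}$ is the cycle on $2n$ vertices. $T_2$ is the tree on vertices $1,\ldots,7$ with edges $\{1,2\},\{2,3\},\{3,4\},\{3,5\},\{4,6\},\{5,7\}$ (three paths of length two sharing the common endpoint $3$). Two letters $a\neq b$ alternate in a word $w$ if the subword of $w$ consisting of all occurrences of $a$ and $b$ is of the form $abab\cdots$ or $baba\cdots$. A word $w$ represents a graph $G=(V,E)$ if for all distinct $a,b\in V$: $\{a,b\}\in E$ if and only if $a$ and $b$ alternate in $w$. $G$ is permutationally $k$-representable if it is represented by a word $p_1p_2\cdots p_k$ where each $p_i$ is a permutation of $V$ (a word containing each vertex exactly once); such a $k$ exists exactly for comparability graphs. The permutation-representation number $\mathcal{R}^p(G)$ of a comparability graph $G$ is the smallest such $k$. *)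

(* Defs.v *)
From mathcomp Require Import all_boot.

Set Implicit Arguments.
Unset Strict Implicit.
Unset Printing Implicit Defensive.

(* A finite simple graph is a symmetric irreflexive [e : rel V] on a finType. *)

Section Graphs.
Variables (V : finType) (e : rel V).

(* A path is the list of all its vertices, both endpoints included, so that
   its length is its size minus one. *)
Definition is_path_between (o o' : V) (p : seq V) : Prop :=
  uniq p /\ exists s : seq V, p = o :: rcons s o'.

Definition path_edge (p : seq V) : rel V :=
  fun x y => infix [:: x; y] p || infix [:: y; x] p.

(* A doubled path of length one would go unnoticed in the edge relation, so
   the absence of parallel edges is imposed on the family of paths. *)
Definition is_melon_of (m : nat) (o o' : V) (E : 'I_m -> seq V) : Prop :=
  [/\ 0 < m /\ o != o',
      forall i, is_path_between o o' (E i),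
      forall i j x, i != j -> x \in E i -> x \in E j -> x = o \/ x = o',
      forall i j, size (E i) = 2 -> size (E j) = 2 -> i = j
    & (forall x, exists i, x \in E i) /\
      (forall x y, e x y <-> exists i, path_edge (E i) x y)].

Definition melon_graph : Prop :=
  exists (m : nat) (o o' : V) (E : 'I_m -> seq V), is_melon_of o o' E.

Definition is_orientation (r : rel V) : Prop :=
  forall x y, (e x y = r x y || r y x) /\ ~~ (r x y && r y x).

Definition comparability_graph : Prop :=
  exists r : rel V, is_orientation r /\ transitive r.

Fixpoint alt_word (a b : V) (n : nat) : seq V :=
  if n is n'.+1 then a :: alt_word b a n' else [::].

Definition alternate (w : seq V) (a b : V) : Prop :=
  exists n : nat, let w' := [seq x <- w | (x == a) || (x == b)] in
    w' = alt_word a b n \/ w' = alt_word b a n.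

Definition represents (w : seq V) : Prop :=
  forall a b, a != b -> (e a b <-> alternate w a b).

Definition perm_representable (k : nat) : Prop :=
  0 < k /\ exists p : 'I_k -> seq V,
    (forall i, perm_eq (p i) (enum V)) /\
    represents (flatten [seq p i | i <- enum 'I_k]).

(* [perm_rep_number k] reads "the permutation-representation number is k". *)
Definition perm_rep_number (k : nat) : Prop :=
  perm_representable k /\ forall j, perm_representable j -> k <= j.

End Graphs.

Definition induced_subgraph (U V : finType) (h : rel U) (e : rel V) : Prop :=
  exists f : U -> V, injective f /\ forall x y, e (f x) (f y) = h x y.

(* [ordS] is the cyclic successor; this is the n-cycle for n >= 3. *)
Definition cycle_graph (n : nat) : rel 'I_n :=
  fun x y => (y == ordS x) || (x == ordS y).

(* The vertex labelled i (1 <= i <= 7) is the ordinal i - 1. *)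
Definition T2_edges : seq (nat * nat) :=
  [:: (1, 2); (2, 3); (3, 4); (3, 5); (4, 6); (5, 7)].

Definition T2 : rel 'I_7 :=
  fun x y => ((x.+1, y.+1) \in T2_edges) || ((y.+1, x.+1) \in T2_edges).

(* Main.v *)
Require Import Defs.
From mathcomp Require Import all_boot zify.

Set Implicit Arguments.
Unset Strict Implicit.
Unset Printing Implicit Defensive.

(** Two letters alternate in a word made of permutations exactly when they come
    in the same order in all of them. So [e] is permutationally [k]-representable
    iff there are [k] linear orders of the vertices such that an edge joins two
    vertices exactly when the [k] orders agree on them
    ([perm_representable_index]); for a comparability graph the least [k] is the
    dimension of the poset given by a transitive orientation.

    Lower bound. If two orders suffice, fix a vertex [z]. The vertices that are
    not adjacent to [z] are either after [z] in the first order and before it in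
    the second, or the reverse, and along a path that avoids [z] and its
    neighbours the same alternative holds throughout. Three pairwise nonadjacent
    vertices, each two of them joined by a path that avoids the neighbourhood of
    the third, are then contradictory
    ([two_orders_no_asteroidal_triple]). Cycles of length at least 6 contain such
    an asteroidal triple (vertices 0, 2, 4), and so does [T2] (its leaves); both
    properties pass to every graph that contains them as induced subgraphs.

    Upper bound. Every vertex of a melon graph is an endpoint or the [k]-th vertex
    of the [i]-th path, and adjacency depends on these coordinates only
    ([melon_graph_coordinates]). A transitive orientation alternates along
    induced paths, which forces the lengths to have the same parity, or, when the
    endpoints are joined by an edge, to be odd or equal to 2
    ([parity_without_rung], [parity_with_rung]). In each case three explicit
    linear orders are written down ([odd_separates], [even_separates]). Their
    principle is the following. A path has dimension at most 2: list its vertices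
    forward, and backward, while respecting the orientation. For a disjoint union
    of paths, list the blocks of vertices of the paths in opposite orders. The
    third order makes room for the endpoints, each of which has to be above its
    nonneighbours in at least one order.

    Dichotomy. If two paths of total length at least 6 form an induced cycle, its
    length is even by the parity constraints; if the endpoints are adjacent and three paths have
    length 3, there is a [T2] centred at an endpoint. Otherwise the melon is a
    single path, a complete bipartite graph with parts of sizes 2 and [m], or an
    edge with paths of length 2 and at most two paths of length 3, and for these
    two orders are enough ([path_separates], [complete_bipartite_separates],
    [short_separates]). *)

(** * Words made of permutations and linear orders *)

Section Words.
Variables (V : finType) (e : rel V).

Lemma filter_pair_index (a b : V) (p : seq V) :
  a != b -> uniq p -> a \in p -> b \in p ->
  [seq x <- p | (x == a) || (x == b)] =
  if index a p < index b p then [:: a; b] else [:: b; a].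
Proof.
have single (x y : V) q : uniq (x :: q) -> y \in q ->
    [seq z <- q | (z == x) || (z == y)] = [:: y].
  case/andP=> xNq q_uniq y_q; rewrite -(filter_pred1_uniq q_uniq y_q).
  by apply: eq_in_filter => z z_q /=; case: (eqVneq z x) z_q xNq => [-> ->|].
move=> ab; elim: p => //= c p IHp /andP[cNp p_uniq]; rewrite !inE.
case: (eqVneq a c) => [ac|_].
  subst c; rewrite (negbTE ab) eq_sym (negbTE ab) /= => _ b_p.
  by rewrite single //= cNp.
case: (eqVneq b c) => [bc|_] /=.
  subst c => a_p _; under eq_filter do rewrite orbC.
  by rewrite single //= cNp.
rewrite ltnS; exact: IHp.
Qed.

(** Removing the first two letters of an alternating word leaves an alternating
    word with the same first letter, so all its blocks of length two are equal. *)
Lemma flatten_alt (a b : V) (s : seq bool) (x : bool) (n : nat) :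
  a != b ->
  flatten [seq if y then [:: a; b] else [:: b; a] | y <- s] =
    alt_word (if x then a else b) (if x then b else a) n ->
  all (pred1 x) s.
Proof.
move=> ab; have ba : b != a by rewrite eq_sym.
elim: s n => //= y s IHs [|[|n]]; first by case: y.
  by case: y => /= [] [].
case: x y IHs => [] [] IHs /= [] //; try exact: IHs.
  by move=> ba'; rewrite ba' eqxx in ba.
by move=> ba'; rewrite ba' eqxx in ab.
Qed.

Lemma alternate_flatten (ps : seq (seq V)) (a b : V) :
  {in ps, forall p, perm_eq p (enum V)} -> a != b ->
  alternate (flatten ps) a b <->
  exists x, all (fun p => (index a p < index b p) == x) ps.
Proof.
move=> ps_perm ab; rewrite /alternate filter_flatten.
have -> : [seq [seq x <- p | (x == a) || (x == b)] | p <- ps] =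
    [seq if y then [:: a; b] else [:: b; a]
      | y <- [seq index a p < index b p | p <- ps]].
  rewrite -map_comp; apply/eq_in_map => p /ps_perm p_perm /=.
  have mem_p x : x \in p by rewrite (perm_mem p_perm) mem_enum.
  by apply: filter_pair_index; rewrite ?(perm_uniq p_perm) ?enum_uniq.
set s := [seq _ | p <- ps].
have alls x : all (fun p => (index a p < index b p) == x) ps = all (pred1 x) s.
  by rewrite all_map.
split=> [[n [] alt]|[x]].
- by exists true; rewrite alls; apply: (flatten_alt (x := true) ab alt).
- by exists false; rewrite alls; apply: (flatten_alt (x := false) ab alt).
rewrite alls => /all_pred1P->; exists (size s).*2.
by case: x; [left | right]; elim: (size s) => //= n ->.
Qed.

Lemma perm_representable_index (k : nat) :
  perm_representable e k <->
  0 < k /\ exists p : 'I_k -> seq V, (forall i, perm_eq (p i) (enum V)) /\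
    forall a b, a != b ->
      e a b = [exists x : bool, forall i, (index a (p i) < index b (p i)) == x].
Proof.
rewrite /perm_representable /represents.
have P (p : 'I_k -> seq V) a b : (forall i, perm_eq (p i) (enum V)) -> a != b ->
    alternate (flatten [seq p i | i <- enum 'I_k]) a b <->
    [exists x : bool, forall i, (index a (p i) < index b (p i)) == x].
  move=> p_perm ab; rewrite alternate_flatten //; last by move=> _ /mapP[i _ ->].
  split=> [[x /allP xP]|/existsP[x /forallP xP]].
    apply/existsP; exists x; apply/forallP=> i; apply: xP.
    by apply: map_f; rewrite mem_enum.
  by exists x; apply/allP => _ /mapP[i _ ->]; apply: xP.
split=> -[k_gt0 [p [p_perm rep]]]; split=> //; exists p; split=> // a b ab.
  by apply/idP/idP => [/(rep a b ab)/P -> //|/(P p a b p_perm ab)/rep ->].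
by rewrite rep //; apply: iff_sym; apply: P.
Qed.

(** Total preorders are enough to represent a graph: sorting breaks the ties in
    some way, and only the strict comparisons are ever relied upon. This frees the
    explicit orders below from ranking the vertices whose order is irrelevant. *)
Lemma perm_representable_preorders (k : nat) (le : 'I_k -> rel V) :
  0 < k -> (forall i, total (le i)) -> (forall i, transitive (le i)) ->
  (forall a b, a != b -> if e a b
     then (forall i, ~~ le i b a) \/ (forall i, ~~ le i a b)
     else (exists i, ~~ le i b a) /\ (exists i, ~~ le i a b)) ->
  perm_representable e k.
Proof.
move=> k_gt0 le_total le_trans sep; apply/perm_representable_index; split=> //.
exists (fun i => sort (le i) (enum V)); split=> [i|a b ab].
  by rewrite perm_sort.
have lt_index i x y : ~~ le i y x ->
    index x (sort (le i) (enum V)) < index y (sort (le i) (enum V)).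
  apply: contraR; rewrite -leqNgt => le_yx.
  apply: (sorted_leq_index (@le_trans i)) le_yx; rewrite ?mem_sort ?mem_enum //.
    by move=> z; have := le_total i z z; rewrite orbb.
  exact: sort_sorted.
move: (sep a b ab); case: (e a b).
  case=> lt_ab; apply/esym/existsP; [exists true | exists false];
    apply/forallP => i; apply/eqP; first exact: lt_index.
  by apply/negbTE; rewrite -leqNgt ltnW // lt_index.
case=> -[i lt_ab] [j lt_ba]; apply/esym/existsP=> -[x /forallP xP].
have:= eqP (xP i); rewrite lt_index // => x1; have:= eqP (xP j).
by rewrite -x1 ltnNge ltnW // lt_index.
Qed.

End Words.

(** * Asteroidal triples exclude two orders *)

Definition away_from (U : finType) (h : rel U) (z : U) : rel U :=
  fun a b => [&& h a b, a != z, b != z, ~~ h z a & ~~ h z b].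

Definition asteroidal_triple (U : finType) (h : rel U) (x y z : U) : Prop :=
  [/\ uniq [:: x; y; z], [&& ~~ h x y, ~~ h y z & ~~ h x z],
      connect (away_from h z) x y, connect (away_from h x) y z
    & connect (away_from h y) z x].

(** The cases [k = 1] and [k = 2] are treated alike, by taking the first and the
    last permutation, which coincide when [k = 1]. *)
Lemma two_orders_of_perm_representable (V : finType) (e : rel V) (k : nat) :
  perm_representable e k -> k <= 2 ->
  exists pos1 pos2 : V -> nat, [/\ injective pos1, injective pos2
    & forall a b, a != b -> e a b = ((pos1 a < pos1 b) == (pos2 a < pos2 b))].
Proof.
move=> /perm_representable_index[k_gt0 [p [p_perm rep]]] k_le2.
have pos_inj i : injective (index^~ (p i)).
  by move=> a b; apply: (index_inj a); rewrite (perm_mem (p_perm i)) mem_enum.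
have lt_pred : k.-1 < k by lia.
exists (index^~ (p (Ordinal k_gt0))), (index^~ (p (Ordinal lt_pred))).
split=> // a b ab; rewrite rep //; apply/existsP/eqP => [[x /forallP xP]|same].
  by rewrite (eqP (xP _)) (eqP (xP _)).
exists (index a (p (Ordinal k_gt0)) < index b (p (Ordinal k_gt0))).
apply/forallP=> i; case: (posnP i) => [i0|i_gt0].
  by have -> : i = Ordinal k_gt0 by apply: val_inj.
have -> : i = Ordinal lt_pred by apply: val_inj => /=; have := ltn_ord i; lia.
by rewrite same.
Qed.

(** Write [side c a] when [a] comes after [c] in the first order. If [a] and [b]
    are adjacent and neither is adjacent to [c], then [side c a = side c b]:
    otherwise [c] would lie between [a] and [b] in both orders, in opposite
    directions, and [a], [b] would not be adjacent. Along the three connections this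
    gives [side z x = side z y], [side x y = side x z] and [side y z = side y x],
    which contradict the antisymmetry of [side]. *)
Lemma two_orders_no_asteroidal_triple (U : finType) (h : rel U)
    (pos1 pos2 : U -> nat) (x y z : U) :
  injective pos1 -> injective pos2 ->
  (forall a b, a != b -> h a b = ((pos1 a < pos1 b) == (pos2 a < pos2 b))) ->
  ~ asteroidal_triple h x y z.
Proof.
move=> inj1 inj2 hE [+ /and3P[hxy hyz hxz] con_z con_x con_y].
rewrite /= !inE negb_or andbT => /andP[/andP[xy xz] yz].
pose side c a := pos1 c < pos1 a.
have neq (pos : U -> nat) a b : injective pos -> a != b -> pos a <> pos b.
  by move=> pos_inj /eqP ab /pos_inj.
have side_step c a b : away_from h c a b -> side c a = side c b.
  case/and5P=> + /[1!eq_sym] ac /[1!eq_sym] bc; case: (eqVneq a b) => [-> //|ab].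
  rewrite /side !hE //; try by rewrite eq_sym.
  case: (ltngtP (pos1 c) (pos1 a)) (neq _ _ _ inj1 ac) => // ca1 _;
    case: (ltngtP (pos2 c) (pos2 a)) (neq _ _ _ inj2 ac) => // ca2 _;
    case: (ltngtP (pos1 c) (pos1 b)) (neq _ _ _ inj1 bc) => // cb1 _;
    case: (ltngtP (pos2 c) (pos2 b)) (neq _ _ _ inj2 bc) => // cb2 _.
  - by rewrite (leq_gtF (ltnW (ltn_trans cb1 ca1))) (ltn_trans ca2 cb2).
  - by rewrite (ltn_trans ca1 cb1) (leq_gtF (ltnW (ltn_trans cb2 ca2))).
have side_connect c a b : connect (away_from h c) a b -> side c a = side c b.
  case/connectP=> p + ->; elim: p a => //= a' p IHp a /andP[/side_step-> ].
  exact: IHp.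
have side_sym a b : a != b -> side a b = ~~ side b a.
  by move=> /(neq _ _ _ inj1); rewrite /side; lia.
have := side_connect _ _ _ con_z; rewrite side_sym 1?eq_sym // => zx_zy.
have := side_connect _ _ _ con_x; have := side_connect _ _ _ con_y.
move: zx_zy; rewrite (side_sym z y) 1?eq_sym // (side_sym y x) 1?eq_sym //.
by case: (side x z) (side x y) (side y z) => [] [] [].
Qed.

Lemma induced_asteroidal_triple_perm_representable
    (U V : finType) (h : rel U) (e : rel V) (x y z : U) (k : nat) :
  induced_subgraph h e -> asteroidal_triple h x y z ->
  perm_representable e k -> 2 < k.
Proof.
move=> [f [f_inj fE]] xyz rep; rewrite ltnNge.
apply/negP=> /(two_orders_of_perm_representable rep)[pos1 [pos2 [inj1 inj2 eE]]].
apply: (@two_orders_no_asteroidal_triple U h (pos1 \o f) (pos2 \o f)) xyz => //.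
- exact: inj_comp.
- exact: inj_comp.
- by move=> a b ab; rewrite -fE eE // (inj_eq f_inj).
Qed.

(** Linear arithmetic does not see through the modulo hidden in [ordS]. *)
Lemma val_cycle_graph (n : nat) (x y : 'I_n) :
  cycle_graph x y =
  [|| y == x.+1 :> nat, x == y.+1 :> nat,
      (x.+1 == n) && (y == 0 :> nat) | (y.+1 == n) && (x == 0 :> nat)].
Proof.
have ordSE (a b : 'I_n) :
    (a == ordS b) = (a == b.+1 :> nat) || (b.+1 == n) && (a == 0 :> nat).
  rewrite -val_eqE /=; have := ltn_ord a; case: (eqVneq b.+1 n) => [bn|bn] a_lt.
    by rewrite [X in X %% _]bn modnn bn; lia.
  by rewrite modn_small ?orbF //; have := ltn_ord b; lia.
by rewrite /cycle_graph !ordSE; lia.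
Qed.

Lemma cycle_asteroidal_triple (n : nat) (x0 : 0 < n) (x2 : 2 < n) (x4 : 4 < n) :
  5 < n ->
  asteroidal_triple (@cycle_graph n) (Ordinal x0) (Ordinal x2) (Ordinal x4).
Proof.
move=> n_gt5; pose away := away_from (@cycle_graph n).
have awayE (c a b : 'I_n) : cycle_graph a b ->
    c != a :> nat -> c != b :> nat -> ~~ cycle_graph c a -> ~~ cycle_graph c b ->
    connect (away c) a b.
  move=> ab ca cb hca hcb; apply: connect1.
  by apply/and5P; split; rewrite // -val_eqE eq_sym.
have x1 : 1 < n by lia.
have x3 : 3 < n by lia.
have last_lt : n.-1 < n by lia.
have from4 t (lt_t : t < n) : 4 <= t ->
    connect (away (Ordinal x2)) (Ordinal x4) (Ordinal lt_t).
  elim: t => // t IHt in lt_t *; rewrite leq_eqVlt => /predU1P[t4|t_ge4].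
    by have -> : Ordinal x4 = Ordinal lt_t by apply: val_inj.
  apply: connect_trans (IHt (ltnW lt_t) t_ge4) _ => {IHt}.
  by apply: awayE; rewrite ?val_cycle_graph /=; lia.
split=> //.
- by rewrite !val_cycle_graph /=; lia.
- by apply: (@connect_trans _ _ (Ordinal x1)); apply: awayE;
    rewrite ?val_cycle_graph /=; lia.
- by apply: (@connect_trans _ _ (Ordinal x3)); apply: awayE;
    rewrite ?val_cycle_graph /=; lia.
apply: (@connect_trans _ _ (Ordinal last_lt)); first by apply: from4; lia.
by apply: awayE; rewrite ?val_cycle_graph /=; lia.
Qed.

Lemma T2_asteroidal_triple :
  asteroidal_triple T2 (@Ordinal 7 0 isT) (@Ordinal 7 5 isT) (@Ordinal 7 6 isT).
Proof.
split=> //; apply/connectP.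
- by exists [:: @Ordinal 7 1 isT; @Ordinal 7 2 isT;
                @Ordinal 7 3 isT; @Ordinal 7 5 isT].
- by exists [:: @Ordinal 7 3 isT; @Ordinal 7 2 isT;
                @Ordinal 7 4 isT; @Ordinal 7 6 isT].
- by exists [:: @Ordinal 7 4 isT; @Ordinal 7 2 isT;
                @Ordinal 7 1 isT; @Ordinal 7 0 isT].
Qed.

(** * Coordinates on a melon graph *)

Inductive melon_point (m : nat) : Type :=
  | Source
  | Sink
  | Inner of 'I_m & nat.

Arguments Source {m}.
Arguments Sink {m}.

Definition valid_point (m : nat) (L : 'I_m -> nat) (p : melon_point m) : bool :=
  if p is Inner i k then 0 < k < L i else true.

(** The edge between the endpoints is a path of length one, which has no inner
    point: its presence is read off the family [L] of path lengths. *)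
Definition melon_adj (m : nat) (L : 'I_m -> nat) : rel (melon_point m) :=
  fun p q => match p, q with
  | Source, Sink | Sink, Source => [exists i, L i == 1]
  | Source, Inner _ k | Inner _ k, Source => k == 1
  | Sink, Inner i k | Inner i k, Sink => k.+1 == L i
  | Inner i k, Inner j l => (i == j) && ((l == k.+1) || (k == l.+1))
  | _, _ => false
  end.

(** Both the coordinates [c] of a vertex and the vertex [v] at a given point are
    kept: orders are pulled back along [c], while embeddings and edges between
    given points are pushed forward along [v]. *)
Definition melon_coordinates (V : finType) (e : rel V) (m : nat)
    (L : 'I_m -> nat) (c : V -> melon_point m) (v : melon_point m -> V) : Prop :=
  [/\ cancel c v, forall p, valid_point L p -> c (v p) = p,
      forall x, valid_point L (c x)
    & forall x y, e x y = melon_adj L (c x) (c y)].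

Lemma infix_pair (T : eqType) (x y : T) (p : seq T) : uniq p ->
  infix [:: x; y] p = [&& x \in p, y \in p & index y p == (index x p).+1].
Proof.
move=> p_uniq; apply/infixP/and3P=> [[p1 [p2 p_def]]|[x_p y_p]].
  move: p_uniq; rewrite p_def /= cat_uniq /= => /and3P[_ xyN /andP[xNyp2 _]].
  move: xyN xNyp2; rewrite !inE !negb_or.
  case/and3P=> xNp1 yNp1 _ /andP[xy _].
  rewrite !mem_cat !inE !eqxx !orbT !index_cat (negbTE xNp1) (negbTE yNp1) /=.
  by rewrite !eqxx (negbTE xy) addn0 addn1.
case/splitPr: x_p p_uniq y_p => p1 p2.
rewrite cat_uniq /= => /and3P[_ + /andP[xNp2 p2_uniq]].
rewrite negb_or => /andP[xNp1 _].
rewrite mem_cat inE !index_cat (negbTE xNp1) /= eqxx addn0.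
case: ifP => [y_p1 _|_] /=.
  by move=> /eqP y1; have := y_p1; rewrite -index_mem y1 ltnNge leqnSn.
rewrite [x == y]eq_sym; case: (y == x) => /= [_|].
  by rewrite addn0 eqn_leq ltnn andbF.
case: p2 xNp2 p2_uniq => //= z p2 _ _ _.
case: (eqVneq z y) => [->|_]; last by move/eqP; lia.
by move=> _; exists p1, p2.
Qed.

Lemma path_edge_index (V : finType) (p : seq V) (x y : V) : uniq p ->
  path_edge p x y = [&& x \in p, y \in p &
    (index y p == (index x p).+1) || (index x p == (index y p).+1)].
Proof.
move=> p_uniq; rewrite /path_edge !infix_pair //.
by case: (x \in p); case: (y \in p).
Qed.

Lemma melon_graph_coordinates (V : finType) (e : rel V) :
  melon_graph e ->
  exists (m : nat) (L : 'I_m -> nat) (c : V -> melon_point m)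
    (v : melon_point m -> V),
  [/\ 0 < m, forall i, 0 < L i & melon_coordinates e L c v].
Proof.
case=> m [o [o' [E [[m_gt0 oo'] E_path E_meet _ [E_cover E_edge]]]]].
pose L i := (size (E i)).-1.
have size_E i : size (E i) = (L i).+1.
  by rewrite /L; have [_ [s ->]] := E_path i.
have L_gt0 i : 0 < L i.
  by rewrite /L; have [_ [s ->]] := E_path i; rewrite /= size_rcons.
have E_uniq i : uniq (E i) by have [] := E_path i.
have nth0 i : nth o (E i) 0 = o by have [_ [s ->]] := E_path i.
have nthL i : nth o (E i) (L i) = o'.
  rewrite /L; have [_ [s ->]] := E_path i.
  by rewrite /= size_rcons /= nth_rcons ltnn eqxx.
have o_E i : o \in E i by rewrite -(nth0 i) mem_nth // size_E.
have o'_E i : o' \in E i by rewrite -(nthL i) mem_nth // size_E.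
have index_o i : index o (E i) = 0.
  by rewrite -{1}(nth0 i) index_uniq // size_E.
have index_o' i : index o' (E i) = L i.
  by rewrite -{1}(nthL i) index_uniq // size_E.
have [f fP] : exists f : V -> 'I_m, forall x, x \in E (f x).
  exact: (@fin_all_exists V (fun _ => ordinal m) (fun x i => x \in E i)).
have f_eq x i : x != o -> x != o' -> x \in E i -> f x = i.
  move=> /eqP xo /eqP xo' x_i; apply/eqP/negPn/negP => fx_i.
  by case: (E_meet _ _ _ fx_i (fP x) x_i).
pose c x := if x == o then Source else if x == o' then Sink
  else Inner (f x) (index x (E (f x))).
pose v p := match p with Source => o | Sink => o' | Inner i k => nth o (E i) k end.
have cV x : valid_point L (c x).
  rewrite /c; case: eqVneq => // xo; case: eqVneq => // xo' /=.
  have x_lt := fP x; move: (x_lt); rewrite -index_mem size_E.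
  have : index x (E (f x)) != 0.
    by apply: contraNneq xo => x0; rewrite -(nth_index o x_lt) x0 nth0.
  have : index x (E (f x)) != L (f x).
    by apply: contraNneq xo' => xL; rewrite -(nth_index o x_lt) xL nthL.
  lia.
have cK : cancel c v.
  move=> x; rewrite /c /v; case: eqVneq => // xo; case: eqVneq => // xo'.
  exact: nth_index.
have vK p : valid_point L p -> c (v p) = p.
  case: p => [||i k] /=; rewrite /c ?eqxx //.
    by rewrite eq_sym (negbTE oo').
  case/andP=> k_gt0 k_lt.
  have k_E : k < size (E i) by rewrite size_E ltnS ltnW.
  have vo : nth o (E i) k != o by rewrite -{2}(nth0 i) nth_uniq // ?size_E //; lia.
  have vo' : nth o (E i) k != o'.
    by rewrite -(nthL i) nth_uniq // ?size_E //; lia.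
  rewrite (negbTE vo) (negbTE vo') (f_eq _ i) ?mem_nth //.
  by rewrite index_uniq.
exists m, L, c, v; split=> //; split=> // x y.
have -> : e x y = [exists i, path_edge (E i) x y].
  by apply/idP/existsP => /E_edge.
have edgeE i : path_edge (E i) x y = _ := path_edge_index x y (E_uniq i).
under eq_existsb => i do rewrite edgeE.
have inner_E z i : z != o -> z != o' -> (z \in E i) = (i == f z).
  move=> zo zo'; apply/idP/eqP=> [|->]; last exact: fP.
  by move/(f_eq z i zo zo').
have exists_at (j : 'I_m) (P : pred 'I_m) : [exists i, (i == j) && P i] = P j.
  apply/existsP/idP=> [[i /andP[/eqP-> //]]|Pj].
  by exists j; rewrite eqxx.
have inner_pos z : z != o -> z != o' -> 0 < index z (E (f z)) < L (f z).
  by move=> zo zo'; have := cV z; rewrite /c (negbTE zo) (negbTE zo').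
rewrite /c; case: (eqVneq x o) => [->|xo].
  case: (eqVneq y o) => [->|yo].
    by apply/existsP=> -[i]; rewrite index_o /= !andbF.
  case: (eqVneq y o') => [->|yo'] /=.
    apply: eq_existsb => i; rewrite o_E o'_E index_o index_o' /=.
    by have := L_gt0 i; lia.
  under eq_existsb => i do rewrite o_E inner_E //= index_o.
  by rewrite exists_at; lia.
case: (eqVneq x o') => [->|xo'].
  case: (eqVneq y o) => [->|yo] /=.
    apply: eq_existsb => i; rewrite o_E o'_E index_o index_o' /=.
    by have := L_gt0 i; lia.
  case: (eqVneq y o') => [->|yo'] /=.
    by apply/existsP=> -[i]; rewrite index_o'; lia.
  under eq_existsb => i do rewrite o'_E inner_E //= index_o'.
  by rewrite exists_at; have := inner_pos y yo yo'; lia.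
have := inner_pos x xo xo'.
case: (eqVneq y o) => [->|yo] /= x_pos.
  under eq_existsb => i do rewrite o_E inner_E //= index_o.
  by rewrite exists_at; lia.
case: (eqVneq y o') => [->|yo'] /=.
  under eq_existsb => i do rewrite o'_E inner_E //= index_o'.
  by rewrite exists_at; lia.
under eq_existsb => i do rewrite !inner_E //.
by rewrite exists_at; case: eqP => [->|].
Qed.

(** * Three orders for comparability melons *)

Definition key : Type := (nat * nat * nat)%type.

Definition key_lt : rel key :=
  fun s t => let: (a, b, c) := s in let: (a', b', c') := t in
    (a < a') || (a == a') && ((b < b') || (b == b') && (c < c')).

(** What the orders given by the keys [Ks] have to do on two points: all agree
    strictly if the points are adjacent, and disagree strictly otherwise. *)
Definition separates (m : nat) (L : 'I_m -> nat) (Ks : seq (melon_point m -> key))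
    (p q : melon_point m) : bool :=
  if melon_adj L p q
  then all (fun K => key_lt (K p) (K q)) Ks || all (fun K => key_lt (K q) (K p)) Ks
  else has (fun K => key_lt (K p) (K q)) Ks && has (fun K => key_lt (K q) (K p)) Ks.

Lemma separates_perm_representable (V : finType) (e : rel V) (m : nat)
    (L : 'I_m -> nat) (c : V -> melon_point m) (v : melon_point m -> V)
    (Ks : seq (melon_point m -> key)) :
  melon_coordinates e L c v -> 0 < size Ks ->
  (forall p q, valid_point L p -> valid_point L q -> p <> q -> separates L Ks p q) ->
  perm_representable e (size Ks).
Proof.
move=> [cK _ c_valid eE] Ks_gt0 sep; pose K0 (p : melon_point m) : key := (0, 0, 0).
pose lt i x y := key_lt (nth K0 Ks i (c x)) (nth K0 Ks i (c y)).
apply: (@perm_representable_preorders V e _ (fun i x y => ~~ lt i y x)) => //.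
- move=> i x y; rewrite /lt; case: (nth _ _ _ _) => [[a b] d].
  by case: (nth _ _ _ _) => [[a' b'] d'] /=; lia.
- move=> i y x z; rewrite /lt; case: (nth _ _ _ _) => [[a b] d].
  case: (nth _ _ _ _) => [[a' b'] d']; case: (nth _ _ _ _) => [[a2 b2] d2] /=; lia.
move=> x y xy; have cxy : c x <> c y by move/(can_inj cK); apply/eqP.
have:= sep _ _ (c_valid x) (c_valid y) cxy; rewrite /separates -eE.
case: (e x y).
  case/orP=> /all_nthP lt_all; [left | right] => i;
    by rewrite negbK; apply: lt_all.
case/andP=> /(has_nthP K0)[i lt_i lt_xy] /(has_nthP K0)[j lt_j lt_yx].
by split; [exists (Ordinal lt_i) | exists (Ordinal lt_j)]; rewrite negbK.
Qed.

(** On a path whose even vertices are the minimal elements, [forward] lists the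
    vertices as 0, 2, 1, 4, 3, 6, ... and [backward] as ..., 6, 4, 5, 2, 3, 0, 1.
    Each of them puts a vertex above its two neighbours if it is odd, and they
    disagree on all nonadjacent pairs. *)
Definition forward (k : nat) : nat := k + (odd k).*2.
Definition backward (l k : nat) : nat := (l - k) + (odd k).*2.

(** Inner vertices when the lengths are odd or, beside an edge between the
    endpoints, equal to 2. On the paths of odd length even positions are minimal and
    odd ones maximal, so the source is minimal and the sink maximal; a [Bridge] is
    the middle of a path of length 2, between the source and the sink in the poset.
    Paths of length 3 are set apart because their position 2 is both next to the
    first inner vertex and the last inner one. *)
Variant odd_role := Bridge | ShortInner | First | Second | Last | Middle.

Definition role (l k : nat) : odd_role :=
  if l == 2 then Bridge else if l == 3 then ShortInner
  else if k == 1 then First else if k == 2 then Second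
  else if k.+1 == l then Last else Middle.

(** How the three orders below cooperate. On paths of length at least 5, the third
    order raises the source above all inner points other than the [First] ones, and
    the second order lowers the sink below all inner points other than the [Last]
    ones. Apart
    from the [First] points in the third order and the [Last] points in the second,
    these two orders list the paths in opposite directions, which makes points of
    different paths incomparable. The first order repairs the exceptions. It puts
    the [First] points early, together with the [Second] points below them, and the
    [Last] points late; it lists the paths by increasing index in the early part,
    against the second order, and by decreasing index in the late part, against
    the third.
    On paths of length 3 both exceptions occur at once: in the third order position
    1 is at the top and position 2 below both endpoints, and it is the first two
    orders that list these paths in opposite directions. *)
Definition odd_key1 (m : nat) (L : 'I_m -> nat) (p : melon_point m) : key :=
  match p with
  | Source => (0, 0, 0)
  | Sink => (5, 0, 0)
  | Inner i k => match role (L i) k with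
    | First | Second => (1, i : nat, forward k)
    | Bridge => (2, i : nat, 0)
    | ShortInner => (3, i : nat, forward k)
    | Last | Middle => (4, m - i, forward k)
    end
  end.

Definition odd_key2 (m : nat) (L : 'I_m -> nat) (p : melon_point m) : key :=
  match p with
  | Source => (0, 0, 0)
  | Sink => (4, 0, 0)
  | Inner i k => match role (L i) k with
    | Last => (1, 0, 0)
    | ShortInner => (2, m - i, forward k)
    | Bridge => (3, m - i, 0)
    | First | Second | Middle => (5, m - i, odd k : nat)
    end
  end.

(** The source has to be below the sink if they are adjacent. If not, they are
    exchanged here, which makes them incomparable; there is no [Bridge] then. *)
Definition odd_key3 (m : nat) (L : 'I_m -> nat) (p : melon_point m) : key :=
  match p with
  | Source => (if [exists i, L i == 1] then 2 else 4, 0, 0)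
  | Sink => (if [exists i, L i == 1] then 4 else 2, 0, 0)
  | Inner i k => match role (L i) k with
    | Second | Last | Middle => (0, i : nat, backward (L i) k)
    | ShortInner => (if k == 1 then 5 else 1, 0, 0)
    | Bridge => (3, 0, 0)
    | First => (5, 0, 0)
    end
  end.

(** In the even case both endpoints are minimal. The sink is raised above its
    nonneighbours in the second order and the source in the third; the inner
    vertices adjacent to the raised endpoint go to the top. On a path of length at
    least 4 such a vertex leaves its path in one of these two orders only, so it
    suffices that both list the paths in one direction and the first order lists
    them in the other. The vertices of the paths of length 2 are at the top of both
    orders, hence at the bottom of the first, just above the endpoints. *)
Definition even_key1 (m : nat) (L : 'I_m -> nat) (p : melon_point m) : key :=
  match p with
  | Source | Sink => (0, 0, 0)
  | Inner i k => if L i == 2 then (1, m - i, 0) else (2, m - i, forward k)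
  end.

Definition even_key2 (m : nat) (L : 'I_m -> nat) (p : melon_point m) : key :=
  match p with
  | Source => (0, 0, 0)
  | Sink => (2, 0, 0)
  | Inner i k => if k.+1 == L i then (3, i : nat, 0) else (1, i : nat, odd k : nat)
  end.

Definition even_key3 (m : nat) (L : 'I_m -> nat) (p : melon_point m) : key :=
  match p with
  | Sink => (0, 0, 0)
  | Source => (2, 0, 0)
  | Inner i k => if k == 1 then (3, i : nat, 0) else (1, i : nat, backward (L i) k)
  end.

Lemma melon_adj_sym (m : nat) (L : 'I_m -> nat) : symmetric (melon_adj L).
Proof.
move=> [||i k] [||j l] //=; rewrite eq_sym; case: eqP => // _ /=.
by rewrite orbC.
Qed.

Lemma separates_sym (m : nat) (L : 'I_m -> nat) (Ks : seq (melon_point m -> key)) p q :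
  separates L Ks p q = separates L Ks q p.
Proof. by rewrite /separates melon_adj_sym orbC andbC. Qed.

Lemma separates_all_pairs (m : nat) (L : 'I_m -> nat)
    (Ks : seq (melon_point m -> key)) :
  separates L Ks Source Sink ->
  (forall i k, 0 < k < L i -> separates L Ks Source (Inner i k)) ->
  (forall i k, 0 < k < L i -> separates L Ks Sink (Inner i k)) ->
  (forall i k l, 0 < k < L i -> 0 < l < L i -> k < l ->
     separates L Ks (Inner i k) (Inner i l)) ->
  (forall i j k l, 0 < k < L i -> 0 < l < L j -> i < j ->
     separates L Ks (Inner i k) (Inner j l)) ->
  forall p q, valid_point L p -> valid_point L q -> p <> q -> separates L Ks p q.
Proof.
move=> sep_ends sep_source sep_sink sep_path sep_paths [||i k] [||j l] //= p_ok q_ok pq.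
- exact: sep_source.
- by rewrite separates_sym.
- exact: sep_sink.
- by rewrite separates_sym sep_source.
- by rewrite separates_sym sep_sink.
case: (ltngtP i j) => [ij|ij|/val_inj ij].
- exact: sep_paths.
- by rewrite separates_sym sep_paths.
subst j; case: (ltngtP k l) => [kl|kl|kl].
- exact: sep_path.
- by rewrite separates_sym sep_path.
by rewrite kl in pq.
Qed.

Ltac decide_order :=
  rewrite /forward /backward;
  repeat match goal with
  | |- context [if ?a == ?b then _ else _] => case: (eqVneq a b) => ? /=
  end; lia.

Lemma even_separates (m : nat) (L : 'I_m -> nat) (p q : melon_point m) :
  (forall i, ~~ odd (L i)) -> valid_point L p -> valid_point L q -> p <> q ->
  separates L [:: even_key1 L; even_key2 L; even_key3 L] p q.
Proof.
move=> L_even; have no_edge : [exists i, L i == 1] = false.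
  by apply/existsP=> -[i /eqP Li]; have := L_even i; rewrite Li.
apply: separates_all_pairs => {p q}; rewrite /separates /=.
- by rewrite no_edge.
- move=> i k k_bd; have := L_even i; decide_order.
- move=> i k k_bd; have := L_even i; decide_order.
- move=> i k l k_bd l_bd kl; have := L_even i; rewrite eqxx /=.
  by case: ifP => adj_kl; decide_order.
move=> i j k l k_bd l_bd ij; have := L_even i; have := L_even j.
have := ltn_ord j; rewrite -val_eqE (ltn_eqF ij) /=.
by decide_order.
Qed.

Lemma odd_separates (m : nat) (L : 'I_m -> nat) (p q : melon_point m) :
  (forall i, odd (L i) || [exists j, L j == 1] && (L i == 2)) ->
  valid_point L p -> valid_point L q -> p <> q ->
  separates L [:: odd_key1 L; odd_key2 L; odd_key3 L] p q.
Proof.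
move=> L_odd; apply: separates_all_pairs => {p q}; rewrite /separates /= /role.
- by case: [exists j, _].
- move=> i k k_bd; have := L_odd i; case: [exists j, _] => /=; decide_order.
- move=> i k k_bd; have := L_odd i; case: [exists j, _] => /=; decide_order.
- move=> i k l k_bd l_bd kl; have := L_odd i; rewrite eqxx /=.
  case: [exists j, _] => /=; case: ifP => adj_kl; decide_order.
move=> i j k l k_bd l_bd ij; have := L_odd i; have := L_odd j.
have := ltn_ord j; rewrite -val_eqE (ltn_eqF ij) /=.
by case: [exists j, _] => /=; decide_order.
Qed.

(** * Two orders for melons without obstruction *)

Definition path_position (m : nat) (L : 'I_m -> nat) (i0 : 'I_m)
    (p : melon_point m) : nat :=
  match p with Source => 0 | Sink => L i0 | Inner _ k => k end.

Lemma path_separates (m : nat) (L : 'I_m -> nat) (i0 : 'I_m) (p q : melon_point m) :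
  (forall i, i = i0) -> 0 < L i0 ->
  valid_point L p -> valid_point L q -> p <> q ->
  separates L [:: fun p => (0, 0, forward (path_position L i0 p));
                  fun p => (0, 0, backward (L i0) (path_position L i0 p))] p q.
Proof.
move=> all_i0 L_gt0; apply: separates_all_pairs => {p q}; rewrite /separates /=.
- have -> : [exists i, L i == 1] = (L i0 == 1).
    by apply/existsP/idP=> [[i]|L1]; [rewrite (all_i0 i) | exists i0].
  by decide_order.
- by move=> i k; rewrite (all_i0 i) => k_bd; decide_order.
- by move=> i k; rewrite (all_i0 i) => k_bd; decide_order.
- move=> i k l; rewrite (all_i0 i) eqxx /= => k_bd l_bd kl.
  by case: ifP => adj_kl; decide_order.
by move=> i j k l _ _; rewrite (all_i0 i) (all_i0 j) ltnn.
Qed.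

Definition bipartite_key (m : nat) (reverse : bool) (p : melon_point m) : key :=
  match p with
  | Source => (reverse : nat, 0, 0)
  | Sink => (~~ reverse : nat, 0, 0)
  | Inner i _ => (2, if reverse then m - i else i, 0)
  end.

Lemma complete_bipartite_separates (m : nat) (L : 'I_m -> nat) (p q : melon_point m) :
  (forall i, L i = 2) -> valid_point L p -> valid_point L q -> p <> q ->
  separates L [:: @bipartite_key m false; @bipartite_key m true] p q.
Proof.
move=> L2; apply: separates_all_pairs => {p q}; rewrite /separates /=.
- by case: existsP => // -[i]; rewrite L2.
- by move=> i k; rewrite L2; case: k => [|[|k]].
- by move=> i k; rewrite L2; case: k => [|[|k]].
- by move=> i k l; rewrite L2; case: k => [|[|k]] //; case: l => [|[|l]].
move=> i j k l _ _ ij; rewrite -val_eqE (ltn_eqF ij) /=.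
by have := ltn_ord j; lia.
Qed.

(** With [o t u o'] the path [a] and [o s w o'] the other path of length 3, the
    orders are [u o t xs w o' s] and [w o s xs u o' t], where [xs] are the middles of
    the paths of length 2, listed in opposite directions. A third path of length 3
    has no place: its last inner vertex would have to precede [o] in one of the
    orders, like [u] or [w], and two such vertices cannot do so in the same order. *)
Definition short_key (m : nat) (L : 'I_m -> nat) (a : 'I_m) (reverse : bool)
    (p : melon_point m) : key :=
  match p with
  | Source => (1, 0, 0)
  | Sink => (5, 0, 0)
  | Inner i k =>
    if L i == 2 then (3, if reverse then m - i else i, 0)
    else if ((i : nat) == (a : nat)) (+) reverse then (if k == 2 then 0 else 2, 0, 0)
    else (if k == 2 then 4 else 6, 0, 0)
  end.

Lemma short_separates (m : nat) (L : 'I_m -> nat) (a : 'I_m) (p q : melon_point m) :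
  [exists i, L i == 1] -> (forall i, L i <= 3) ->
  (forall i j, i != a -> j != a -> L i = 3 -> L j = 3 -> i = j) ->
  valid_point L p -> valid_point L q -> p <> q ->
  separates L [:: short_key L a false; short_key L a true] p q.
Proof.
move=> rung L_le3 two_long; apply: separates_all_pairs => {p q}; rewrite /separates /=.
- by rewrite rung.
- by move=> i k k_bd; have := L_le3 i; case: (eqVneq (i : nat) a) => _ /=;
    decide_order.
- by move=> i k k_bd; have := L_le3 i; case: (eqVneq (i : nat) a) => _ /=;
    decide_order.
- move=> i k l k_bd l_bd kl; have := L_le3 i; rewrite eqxx /=.
  by case: ifP => adj_kl; case: (eqVneq (i : nat) a) => _ /=; decide_order.
move=> i j k l k_bd l_bd ij; have := L_le3 i; have := L_le3 j.
have := ltn_ord j; rewrite -val_eqE (ltn_eqF ij) /=.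
have : ~~ [&& i != a :> nat, j != a :> nat, L i == 3 & L j == 3].
  apply/negP=> /and4P[ia ja /eqP Li /eqP Lj].
  by move: ij; rewrite (two_long i j ia ja Li Lj) ltnn.
by case: (eqVneq (i : nat) a) => ia; case: (eqVneq (j : nat) a) => ja /=;
  decide_order.
Qed.

(** * The obstructions inside a melon *)

Section InducedSubgraphs.

Variables (V : finType) (e : rel V) (m : nat) (L : 'I_m -> nat).
Variables (c : V -> melon_point m) (v : melon_point m -> V).
Hypothesis coords : melon_coordinates e L c v.

Lemma coordinates_induced_subgraph (U : finType) (h : rel U)
    (f : U -> melon_point m) :
  (forall x, valid_point L (f x)) -> injective f ->
  (forall x y, melon_adj L (f x) (f y) = h x y) -> induced_subgraph h e.
Proof.
case: coords => _ vK _ eE f_valid f_inj fE.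
exists (v \o f); split=> [x y /= /(congr1 c)|x y /=]; last by rewrite eE !vK.
by rewrite !vK // => /f_inj.
Qed.

(** The cycle runs along the path [i] from source to sink and returns along the
    path [j]. It has no chord because an edge between the endpoints can only be the
    path [i] itself. *)
Lemma induced_cycle (i j : 'I_m) (n : nat) :
  i != j -> 0 < L i -> 1 < L j -> L i + L j = 2 * n ->
  ([exists l, L l == 1] -> L i = 1) -> 2 < n ->
  induced_subgraph (@cycle_graph (2 * n)) e.
Proof.
move=> ij Li Lj Lij rung n_gt2.
have ji : (j == i) = false by rewrite eq_sym; apply/negbTE.
pose f (x : 'I_(2 * n)) : melon_point m :=
  if x == 0 :> nat then Source else if x == L i :> nat then Sink
  else if x < L i then Inner i x else Inner j (2 * n - x).
have rungE : [exists l, L l == 1] = (L i == 1).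
  by apply/idP/eqP => [/rung //|Li1]; apply/existsP; exists i; apply/eqP.
apply: (@coordinates_induced_subgraph _ _ f).
- move=> x; have x_lt := ltn_ord x; rewrite /f.
  case: eqVneq => // x0; case: eqVneq => // xL.
  by case: ltnP => /= xi; lia.
- move=> x y; have := ltn_ord x; have := ltn_ord y; rewrite /f => ylt xlt xy.
  apply: val_inj => /=; move: xy.
  case: (eqVneq (x : nat) 0) => x0; case: (eqVneq (y : nat) 0) => y0;
  case: (eqVneq (x : nat) (L i)) => xL; case: (eqVneq (y : nat) (L i)) => yL;
  case: (ltnP x (L i)) => xi; case: (ltnP y (L i)) => yi //; try lia.
  + by case.
  + by case=> /eqP; rewrite (negbTE ij).
  + by case=> /eqP; rewrite ji.
  + by case; lia.
move=> x y; have := ltn_ord x; have := ltn_ord y; rewrite val_cycle_graph /f.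
case: (eqVneq (x : nat) 0) => x0; case: (eqVneq (y : nat) 0) => y0;
case: (eqVneq (x : nat) (L i)) => xL; case: (eqVneq (y : nat) (L i)) => yL;
case: (ltnP x (L i)) => xi; case: (ltnP y (L i)) => yi /=;
rewrite ?rungE ?ji ?(negbTE ij) ?eqxx /=; lia.
Qed.

(** The centre is the source, the legs are the inner vertices of the three paths;
    the sink is left out. *)
Lemma induced_T2 (i1 i2 i3 : 'I_m) :
  i1 != i2 -> i2 != i3 -> i1 != i3 -> L i1 = 3 -> L i2 = 3 -> L i3 = 3 ->
  induced_subgraph T2 e.
Proof.
move=> i12 i23 i13 L1 L2 L3.
pose f (x : 'I_7) := nth Source
  [:: Inner i1 2; Inner i1 1; Source; Inner i2 1; Inner i3 1; Inner i2 2; Inner i3 2] x.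
have [i21 i32 i31] : [/\ i2 != i1, i3 != i2 & i3 != i1].
  by split; rewrite eq_sym.
have neq := (negbTE i12, negbTE i23, negbTE i13, negbTE i21, negbTE i32,
             negbTE i31).
apply: (@coordinates_induced_subgraph _ _ f).
- by case=> [[|[|[|[|[|[|[|x]]]]]]]] //= x_lt; rewrite ?L1 ?L2 ?L3.
- move=> [x x_lt] [y y_lt] xy; apply: val_inj => /=; move: xy; rewrite /f /=.
  case: x x_lt => [|[|[|[|[|[|[|x]]]]]]] // _;
  case: y y_lt => [|[|[|[|[|[|[|y]]]]]]] // _ //=;
  by case=> /eqP; rewrite neq.
move=> [x x_lt] [y y_lt]; rewrite /f /T2 /=.
case: x x_lt => [|[|[|[|[|[|[|x]]]]]]] // _;
case: y y_lt => [|[|[|[|[|[|[|y]]]]]]] // _ /=;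
by rewrite ?eqxx ?neq.
Qed.

End InducedSubgraphs.

(** * What a transitive orientation imposes on the lengths *)

(** An arc into [y] followed by an arc out of [y] would make [x] and [z] adjacent. *)
Lemma transitive_orientation_zigzag (V : finType) (e r : rel V) (x y z : V) :
  is_orientation e r -> transitive r ->
  e x y -> e z y -> ~~ e x z -> r x y = r z y.
Proof.
move=> r_or r_tr exy ezy; have [-> _] := r_or x z; rewrite negb_or.
case/andP=> xzN zxN; have [xyE _] := r_or x y; have [zyE _] := r_or z y.
move: exy ezy; rewrite xyE zyE => exy ezy.
apply/idP/idP => [rxy|rzy]; apply: contraT => /negbTE rN.
  by move: ezy; rewrite rN => /(r_tr _ _ _ rxy); rewrite (negbTE xzN).
by move: exy; rewrite rN => /(r_tr _ _ _ rzy); rewrite (negbTE zxN).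
Qed.

Section Comparability.

Variables (V : finType) (e : rel V) (m : nat) (L : 'I_m -> nat).
Variables (c : V -> melon_point m) (v : melon_point m -> V).
Hypothesis coords : melon_coordinates e L c v.
Hypothesis L_gt0 : forall i, 0 < L i.
Variable r : rel V.
Hypotheses (r_or : is_orientation e r) (r_tr : transitive r).

Definition path_point (i : 'I_m) (k : nat) : melon_point m :=
  if k == 0 then Source else if k == L i then Sink else Inner i k.

Lemma valid_path_point i k : k <= L i -> valid_point L (path_point i k).
Proof. by rewrite /path_point; case: eqVneq => // ?; case: eqVneq => //= ?; lia. Qed.

Let edgeE p q : valid_point L p -> valid_point L q -> e (v p) (v q) = melon_adj L p q.
Proof. by case: coords => _ vK _ eE p_ok q_ok; rewrite eE !vK. Qed.

Let step p q : valid_point L p -> valid_point L q -> melon_adj L p q ->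
  r (v p) (v q) = ~~ r (v q) (v p).
Proof.
move=> p_ok q_ok; rewrite -edgeE //; have [-> ] := r_or (v p) (v q).
by case: (r (v p) _); case: (r (v q) _).
Qed.

Let turn p q s : valid_point L p -> valid_point L q -> valid_point L s ->
  melon_adj L p q -> melon_adj L s q -> ~~ melon_adj L p s ->
  r (v p) (v q) = r (v s) (v q).
Proof.
move=> p_ok q_ok s_ok pq sq ps.
by apply: (transitive_orientation_zigzag r_or r_tr); rewrite edgeE.
Qed.

(** Consecutive edges of the path are both oriented towards their common vertex
    or both away from it, unless its two neighbours are adjacent; these are then the endpoints, on
    a path of length 2 beside an edge. *)
Lemma path_alternates (i : 'I_m) (k : nat) :
  (L i == 2) && [exists j, L j == 1] = false -> k < L i ->
  r (v (path_point i k)) (v (path_point i k.+1)) =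
  r (v Source) (v (path_point i 1)) (+) odd k.
Proof.
move=> Li; elim: k => [|k IHk] k_lt; first by rewrite addbF.
have ok l : l <= L i -> valid_point L (path_point i l) := @valid_path_point i l.
have adj l : l < L i -> melon_adj L (path_point i l) (path_point i l.+1).
  rewrite /path_point => l_lt; case: (eqVneq l 0) => [->|l0] /=.
    by case: eqVneq => //= L1; apply/existsP; exists i; rewrite -L1.
  rewrite ltn_eqF //; case: (eqVneq l.+1 (L i)) => [lL|_] /=.
    by rewrite lL eqxx.
  by rewrite !eqxx.
have adj2 : ~~ melon_adj L (path_point i k) (path_point i k.+2).
  rewrite /path_point /= [k == L i]ltn_eqF 1?ltnW //.
  case: (eqVneq k.+2 (L i)) => kL; case: (eqVneq k 0) => k0 //=.
  - by move: Li; rewrite -kL k0 eqxx /= => ->.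
  - by rewrite -kL; lia.
  by rewrite eqxx; lia.
have ok2 : k.+2 <= L i := k_lt; have ok1 := ltnW ok2; have ok0 := ltnW ok1.
have k1_adj : melon_adj L (path_point i k.+2) (path_point i k.+1).
  by rewrite melon_adj_sym adj.
rewrite step ?ok ?adj //.
rewrite -(turn (ok _ ok0) (ok _ ok1) (ok _ ok2)) ?adj //.
by rewrite IHk 1?ltnW //= addbN.
Qed.

Lemma path_parity (i : 'I_m) :
  (L i == 2) && [exists j, L j == 1] = false ->
  r (v Sink) (v (path_point i (L i).-1)) =
  r (v Source) (v (path_point i 1)) (+) odd (L i).
Proof.
move=> Li; have Lp : (L i).-1 < L i by rewrite ltn_predL.
have := path_alternates Li Lp; rewrite (ltn_predK (L_gt0 i)).
have SinkE : path_point i (L i) = Sink.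
  by rewrite /path_point gtn_eqF // eqxx.
rewrite SinkE => alt; rewrite step.
- by rewrite alt -{2}(ltn_predK (L_gt0 i)) /= addbN.
- by [].
- by apply: valid_path_point; exact: ltnW.
rewrite melon_adj_sym /path_point; case: eqVneq => [L1|L1] /=.
  by apply/existsP; exists i; have := L_gt0 i; lia.
by rewrite ltn_eqF //= prednK.
Qed.

(** The edges at the source are all oriented alike, and so are the edges at the
    sink, because neighbours of an endpoint on different paths are not adjacent.
    As the orientation alternates along each path, its two ends determine the
    parity of the length. *)
Lemma parity_without_rung (i j : 'I_m) :
  ~~ [exists l, L l == 1] -> odd (L i) = odd (L j).
Proof.
move=> rungN; case: (eqVneq i j) => [-> //|ij].
have L_gt1 l : 1 < L l.
  rewrite ltn_neqAle L_gt0 andbT eq_sym.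
  by apply: contra rungN => L1; apply/existsP; exists l.
have inner l k : 0 < k < L l -> path_point l k = Inner l k.
  by rewrite /path_point => k_bd; rewrite !ifN //; lia.
have Lp l : 0 < (L l).-1 < L l by have := L_gt1 l; lia.
have NN l : (L l == 2) && [exists j, L j == 1] = false.
  by rewrite (negbTE rungN) andbF.
have := path_parity (NN i); have := path_parity (NN j).
rewrite !inner ?Lp ?L_gt1 // => pj pi.
have src : r (v (Inner i 1)) (v Source) = r (v (Inner j 1)) (v Source).
  by apply: turn; rewrite //= ?L_gt1 // (negbTE ij).
have snk : r (v (Inner i (L i).-1)) (v Sink) = r (v (Inner j (L j).-1)) (v Sink).
  by apply: turn; rewrite //= ?Lp ?prednK // (negbTE ij).
have srcE l : r (v Source) (v (Inner l 1)) = ~~ r (v (Inner l 1)) (v Source).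
  by apply: step => //=; apply: L_gt1.
have snkE l : r (v Sink) (v (Inner l (L l).-1)) = ~~ r (v (Inner l (L l).-1)) (v Sink).
  by apply: step; rewrite //= ?Lp ?prednK.
move: pi pj; rewrite !srcE !snkE src snk => ->.
by move/addbI.
Qed.

(** At the source the edge between the endpoints is oriented like the first edge
    of the path, at the sink like the last. It points away from one endpoint and
    into the other, so the alternating path does so too: its length is odd. *)
Lemma parity_with_rung (i : 'I_m) :
  [exists l, L l == 1] -> odd (L i) || (L i == 2).
Proof.
move=> rung; case: (eqVneq (L i) 2) => [_|L2]; first by rewrite orbT.
case: (eqVneq (L i) 1) => [-> //|L1]; rewrite orbF.
have L_gt2 : 2 < L i by have := L_gt0 i; lia.
have NN : (L i == 2) && [exists j, L j == 1] = false by rewrite (negbTE L2).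
have := path_parity NN.
have inner k : 0 < k < L i -> path_point i k = Inner i k.
  by rewrite /path_point => k_bd; rewrite !ifN //; lia.
have Lp : 0 < (L i).-1 < L i by lia.
have L1_lt : 0 < 1 < L i by lia.
rewrite !inner //.
have src : r (v (Inner i 1)) (v Source) = r (v Sink) (v Source).
  by apply: turn; rewrite //= ?L1_lt //; lia.
have snk : r (v (Inner i (L i).-1)) (v Sink) = r (v Source) (v Sink).
  by apply: turn; rewrite //= ?Lp ?prednK //; lia.
have -> : r (v Source) (v (Inner i 1)) = ~~ r (v (Inner i 1)) (v Source).
  by apply: step; rewrite //= L1_lt.
have -> : r (v Sink) (v (Inner i (L i).-1)) = ~~ r (v (Inner i (L i).-1)) (v Sink).
  by apply: step; rewrite //= ?Lp ?prednK.
rewrite src snk (step (isT : valid_point L Source) (isT : valid_point L Sink) rung).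
by case: (r _ _) (odd _) => [] [].
Qed.

End Comparability.

(** * The permutation-representation number *)

Lemma melon_perm_representable3 (V : finType) (e : rel V) (m : nat)
    (L : 'I_m -> nat) (c : V -> melon_point m) (v : melon_point m -> V) :
  0 < m -> (forall i, 0 < L i) -> melon_coordinates e L c v ->
  comparability_graph e -> perm_representable e 3.
Proof.
move=> m_gt0 L_gt0 coords [r [r_or r_tr]]; pose i0 := Ordinal m_gt0.
have [L_odd|L_even] : (forall i, odd (L i) || [exists j, L j == 1] && (L i == 2))
    \/ (forall i, ~~ odd (L i)).
- case: (boolP [exists j, L j == 1]) => rung.
    by left=> i; exact: (parity_with_rung coords L_gt0 r_or r_tr i rung).
  have par i := parity_without_rung coords L_gt0 r_or r_tr i i0 rung.
  by case: (boolP (odd (L i0))) => Li0; [left | right] => i; rewrite par ?Li0.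
- apply: (separates_perm_representable coords (Ks := [:: _; _; _])) => // p q.
  exact: odd_separates.
apply: (separates_perm_representable coords (Ks := [:: _; _; _])) => // p q.
exact: even_separates.
Qed.

(** With an edge between the endpoints, a path of length at least 4, hence odd and
    at least 5, closes with that edge a long even cycle. If there is none, all
    lengths are at most 3 and the number of paths of length 3 decides. Without that
    edge all lengths have one parity and are at least 2, so any two paths close an
    induced even cycle, which has length 4 only when both have length 2. *)
Lemma melon_perm_representable2_or_obstruction (V : finType) (e : rel V) (m : nat)
    (L : 'I_m -> nat) (c : V -> melon_point m) (v : melon_point m -> V) :
  0 < m -> (forall i, 0 < L i) -> melon_coordinates e L c v ->
  comparability_graph e ->
  perm_representable e 2 \/
  (exists n : nat, 3 <= n /\ induced_subgraph (@cycle_graph (2 * n)) e) \/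
  induced_subgraph T2 e.
Proof.
move=> m_gt0 L_gt0 coords [r [r_or r_tr]]; pose i0 := Ordinal m_gt0.
have two_keys K1 K2 : (forall p q, valid_point L p -> valid_point L q -> p <> q ->
    separates L [:: K1; K2] p q) -> perm_representable e 2.
  exact: (separates_perm_representable coords (Ks := [:: K1; K2])).
case: (boolP [exists j, L j == 1]) => rung.
  have par i := parity_with_rung coords L_gt0 r_or r_tr i rung.
  have [a0 /eqP La0] := existsP rung.
  case: (boolP [exists i, 3 < L i]) => [/existsP[i Li]|L_le3].
    (* The path [i] and the edge form a cycle of length [L i + 1]. *)
    right; left; exists (L i).+1./2; split; first by have := par i; lia.
    apply: (induced_cycle (i := a0) (j := i) coords); rewrite ?La0 //.
    - by apply: contraTneq Li => <-; rewrite La0.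
    - by lia.
    - by have := par i; lia.
    - by have := par i; lia.
  have {}L_le3 i : L i <= 3.
    by rewrite leqNgt; apply: contra L_le3 => Li; apply/existsP; exists i.
  (* If no path has length 3, any path may stand for [a]. *)
  pose a := odflt a0 [pick i | L i == 3].
  case: (boolP [exists i, exists j, [&& i != a, j != a, i != j, L i == 3 & L j == 3]]).
    case/existsP=> i /existsP[j /and5P[ia ja ij /eqP Li /eqP Lj]]; right; right.
    have La : L a = 3.
      by rewrite /a; case: pickP => [a' /eqP //|/(_ i)]; rewrite Li.
    exact: (induced_T2 (i1 := i) (i2 := j) (i3 := a) coords).
  move=> noN; left; apply: two_keys => p q; apply: (@short_separates _ _ a) => //.
  move=> i j ia ja Li Lj; apply/eqP; apply: contraR noN => ij.
  by apply/existsP; exists i; apply/existsP; exists j; rewrite ia ja ij Li Lj.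
have par i j := parity_without_rung coords L_gt0 r_or r_tr i j rung.
have L_gt1 i : 1 < L i.
  rewrite ltn_neqAle L_gt0 andbT eq_sym.
  by apply: contra rung => L1; apply/existsP; exists i.
case: (boolP [exists i, L i != 2]) => [/existsP[i Li]|L2]; last first.
  left; apply: two_keys => p q; apply: complete_bipartite_separates => i.
  by apply/eqP; apply: contraR L2 => Li; apply/existsP; exists i.
case: (boolP [exists j, i != j]) => [/existsP[j ij]|all_i].
  have := par i j; have := L_gt1 i; have := L_gt1 j => Lj_gt1 Li_gt1 par_ij.
  right; left; exists (L i + L j)./2; split; first by lia.
  apply: (induced_cycle (i := i) (j := j) coords) => //; lia.
left; apply: two_keys => p q; apply: (@path_separates _ _ i) => // j.
by apply/eqP; apply: contraR all_i => ij; apply/existsP; exists j; rewrite eq_sym.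
Qed.

Theorem theorem8 (V : finType) (e : rel V)
    (e_sym : symmetric e) (e_irr : irreflexive e)
    (e_melon : melon_graph e) (e_comp : comparability_graph e) :
  perm_rep_number e 3 <->
  (exists n : nat, 3 <= n /\ induced_subgraph (@cycle_graph (2 * n)) e) \/
  induced_subgraph T2 e.
Proof.
have [m [L [c [v [m_gt0 L_gt0 coords]]]]] := melon_graph_coordinates e_melon.
split=> [[_ min3]|obstruction].
  have [rep2|//] :=
    melon_perm_representable2_or_obstruction m_gt0 L_gt0 coords e_comp.
  by have := min3 2 rep2.
split; first exact: melon_perm_representable3 coords e_comp.
move=> k rep; case: obstruction => [[n [n_ge3 cycle_in_e]]|T2_in_e].
  have [lt0 lt2 lt4 lt5] : [/\ 0 < 2 * n, 2 < 2 * n, 4 < 2 * n & 5 < 2 * n] by split; lia.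
  exact: (induced_asteroidal_triple_perm_representable cycle_in_e
    (cycle_asteroidal_triple lt0 lt2 lt4 lt5)).
exact: (induced_asteroidal_triple_perm_representable T2_in_e T2_asteroidal_triple).
Qed.
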